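(* Let $A=\mathbb{C}\langle u^{\pm1},v^{\pm1}\rangle$, equipped with the double quasi-Poisson bracket $\{\!\!\{-,-\}\!\!\}$ and anti-involution $\phi$ described in the context, let $\lambda\in\mathbb{C}$, and set $h_\lambda=u+v+u^{-1}+v^{-1}+\lambda(u^{-1}v^{-1}+vu)$. The (Hamiltonian) element $h_\lambda$ defines, through $\frac{\mathrm{d}a}{\mathrm{d}t}=\mathrm{m}\circ\{\!\!\{h_\lambda,a\}\!\!\}$, the system $$\frac{\mathrm{d}u}{\mathrm{d}t}=uv-uv^{-1}-\lambda v^{-1}+\lambda uvu,\qquad\frac{\mathrm{d}v}{\mathrm{d}t}=vu^{-1}-vu+\lambda u^{-1}-\lambda vuv,$$ which satisfies: (i) $vuv^{-1}u^{-1}\in A$ is a first integral; (ii) the class in $A/[A,A]$ of any $\phi$-invariant element $h_\lambda^m$ ($m\ge1$) is a first integral, and these classes pairwise commute under $\{-,-\}_\sharp$; (iii) the previous statements are also valid on the representation space $\mathrm{Rep}(A,N)$, $N\ge1$, and on the twisted representation space $\mathrm{Rep}^{\phi,\tau}(A,N)$ (orthogonal type, or symplectic type with $N$ even). That is, $\mathtt{X}(vuv^{-1}u^{-1})$ is a (matrix) first integral, and the elements $(\mathrm{tr}(h_\lambda^m))_{m\ge1}$ are first integrals that pairwise commute under the induced bracket on the (twisted) representation space.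
   Context: $A=\mathbb{C}\langle u^{\pm1},v^{\pm1}\rangle$ is the algebra of noncommutative Laurent polynomials (group algebra of the free group on $u,v$). Write $d=d'\otimes d''\in A\otimes A$; $(d'\otimes d'')^\circ=d''\otimes d'$; $a\,d\,b=ad'\otimes d''b$; $a\ast d\ast b=d'b\otimes ad''$; $\mathrm{m}:A\otimes A\to A$ is multiplication. The double bracket $\{\!\!\{-,-\}\!\!\}:A\times A\to A\otimes A$ is the unique $\mathbb{C}$-bilinear map with $\{\!\!\{a,b\}\!\!\}=-\{\!\!\{b,a\}\!\!\}^\circ$, $\{\!\!\{a,bc\}\!\!\}=\{\!\!\{a,b\}\!\!\}c+b\{\!\!\{a,c\}\!\!\}$, $\{\!\!\{bc,a\}\!\!\}=\{\!\!\{b,a\}\!\!\}\ast c+b\ast\{\!\!\{c,a\}\!\!\}$ and $$\{\!\!\{v,v\}\!\!\}=\tfrac12(v^2\otimes1-1\otimes v^2),\quad\{\!\!\{u,u\}\!\!\}=-\tfrac12(u^2\otimes1-1\otimes u^2),\quad\{\!\!\{v,u\}\!\!\}=\tfrac12(uv\otimes1+1\otimes vu-v\otimes u+u\otimes v).$$ (It is a double quasi-Poisson bracket.) $\phi:A\to A$ is the involutive anti-automorphism with $\phi(u)=u^{-1}$, $\phi(v)=v^{-1}$; note $\phi(h_\lambda)=h_\lambda$. $[A,A]$ is the vector subspace spanned by commutators, and $\{-,-\}_\sharp$ is the Lie bracket on $A/[A,A]$ induced by $\mathrm{m}\circ\{\!\!\{-,-\}\!\!\}$. An element of $A$ is a first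 integral if its time derivative ($a\mapsto\mathrm{m}\circ\{\!\!\{h_\lambda,a\}\!\!\}$) vanishes; a class in $A/[A,A]$ is a first integral if its derivative vanishes in $A/[A,A]$. $\mathbb{C}[\mathrm{Rep}(A,N)]$ is the commutative algebra generated by $a_{ij}$ ($a\in A$, $1\le i,j\le N$), linear in $a$, with $(ab)_{ij}=\sum_ra_{ir}b_{rj}$, $1_{ij}=\delta_{ij}$; $\mathtt{X}(a)=(a_{ij})$, $\mathrm{tr}(a)=\sum_ia_{ii}$; $(c\otimes d)_{kj,il}=c_{kj}d_{il}$. The induced bracket on $\mathrm{Rep}(A,N)$ is the antisymmetric biderivation with $\{a_{ij},b_{kl}\}=\{\!\!\{a,b\}\!\!\}_{kj,il}$. $\mathrm{Rep}^{\phi,\tau}(A,N)$: in the orthogonal case its coordinate ring is the quotient of $\mathbb{C}[\mathrm{Rep}(A,N)]$ by the ideal generated by $\phi(a)_{ij}-a_{ji}$, with induced bracket $\{a_{ij},b_{kl}\}_{\phi,\mathrm{O}}=\frac12\{\!\!\{a,b\}\!\!\}_{kj,il}+\frac12\{\!\!\{\phi(a),b\}\!\!\}_{ki,jl}$. In the symplectic case ($N=2n$), put $\mathrm{sgn}(k)=+1$, $\tau(k)=k+n$ for $k\le n$ and $\mathrm{sgn}(k)=-1$, $\tau(k)=k-n$ for $k>n$; the coordinate ring is the quotient by the ideal generated by $\phi(a)_{ij}-\mathrm{sgn}(i)\mathrm{sgn}(j)a_{\tau(j),\tau(i)}$, with induced bracket $\{a_{ij},b_{kl}\}_{\phi,\mathrm{Sp}}=\frac12\{\!\!\{a,b\}\!\!\}_{kj,il}+\frac12\mathrm{sgn}(i)\mathrm{sgn}(j)\{\!\!\{\phi(a),b\}\!\!\}_{k\tau(i),\tau(j)l}$.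 On each of these spaces, the dynamics is the Hamiltonian flow $\frac{\mathrm d}{\mathrm dt}=\{\mathrm{tr}(h_\lambda),-\}$ for the induced bracket, and the system is the displayed one with $u,v$ replaced by $\mathtt{X}(u),\mathtt{X}(v)$. *)

(* Defs.v *)
From HB Require Import structures.
From mathcomp Require Import all_boot all_algebra.
From mathcomp Require Import generic_quotient finmap boolp.
From mathcomp.multinomials Require Import monalg.

Set Implicit Arguments.
Unset Strict Implicit.
Unset Printing Implicit Defensive.

Import GRing.Theory.
Local Open Scope ring_scope.
Local Open Scope quotient_scope.

Section LinearQuotient.
Variables (F : fieldType) (V : lmodType F) (S : V -> Prop).

Definition lspan (z : V) : Prop :=
  exists s : seq (F * V),
    (forall x, x \in s -> S x.2) /\ z = \sum_(x <- s) x.1 *: x.2.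

Lemma lspan0 : lspan 0.
Proof. by exists [::]; rewrite big_nil. Qed.

Lemma lspan_sub z : S z -> lspan z.
Proof.
move=> Sz; exists [:: (1, z)]; rewrite big_seq1 scale1r; split=> // x.
by rewrite inE => /eqP->.
Qed.

Lemma lspanD x y : lspan x -> lspan y -> lspan (x + y).
Proof.
move=> [s [Ss ->]] [t [St ->]]; exists (s ++ t); rewrite big_cat; split=> // z.
by rewrite mem_cat => /orP[/Ss|/St].
Qed.

Lemma lspanZ c x : lspan x -> lspan (c *: x).
Proof.
move=> [s [Ss ->]]; exists [seq (c * y.1, y.2) | y <- s]; split.
  by move=> _ /mapP[y ys ->]; exact: (Ss y).
by rewrite big_map scaler_sumr; apply: eq_bigr => y _; rewrite scalerA.
Qed.

Lemma lspanN x : lspan x -> lspan (- x).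
Proof. by rewrite -scaleN1r; exact: lspanZ. Qed.

Definition lequiv (x y : V) : bool := `[< lspan (x - y) >].

Lemma lequiv_is_equiv : equiv_class_of lequiv.
Proof.
split=> [x|x y|y x z].
- by apply/asboolP; rewrite subrr; exact: lspan0.
- by apply/asboolP/asboolP => /lspanN; rewrite opprB.
move=> /asboolP xy /asboolP yz; apply/asboolP.
by rewrite -[x](subrK y) -addrA; exact: lspanD.
Qed.

Canonical lequiv_equiv := EquivRelPack lequiv_is_equiv.
Canonical lequiv_encModRel := defaultEncModRel lequiv.

Definition lquot := {eq_quot lequiv}.

HB.instance Definition _ : EqQuotient V lequiv lquot := EqQuotient.on lquot.
HB.instance Definition _ := Choice.on lquot.

Definition lproj (x : V) : lquot := \pi_lquot x.

Lemma lprojP x y : lproj x = lproj y <-> lspan (x - y).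
Proof.
split=> [/eqP|xy]; first by rewrite /lproj piE => /asboolP.
by apply/eqP; rewrite /lproj piE; apply/asboolP.
Qed.

Lemma lprojK (x : lquot) : lproj (repr x) = x.
Proof. exact: reprK. Qed.

Lemma lspan_repr x : lspan (repr (lproj x) - x).
Proof. by apply/lprojP; rewrite lprojK. Qed.

Let zero := lproj 0.
Let opp (x : lquot) := lproj (- repr x).
Let add (x y : lquot) := lproj (repr x + repr y).
Let scale (c : F) (x : lquot) := lproj (c *: repr x).

Let projN x : opp (lproj x) = lproj (- x).
Proof. by apply/lprojP; rewrite -opprD; apply/lspanN/lspan_repr. Qed.

Let projD x y : add (lproj x) (lproj y) = lproj (x + y).
Proof. by apply/lprojP; rewrite opprD addrACA; apply: lspanD; exact: lspan_repr. Qed.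

Let projZ c x : scale c (lproj x) = lproj (c *: x).
Proof. by apply/lprojP; rewrite -scalerBr; apply/lspanZ/lspan_repr. Qed.

Let addA : associative add.
Proof.
by move=> x y z; rewrite -[x]lprojK -[y]lprojK -[z]lprojK !projD addrA.
Qed.

Let addC : commutative add.
Proof. by move=> x y; rewrite -[x]lprojK -[y]lprojK !projD addrC. Qed.

Let add0 : left_id zero add.
Proof. by move=> x; rewrite -[x]lprojK projD add0r. Qed.

Let addN : left_inverse zero opp add.
Proof. by move=> x; rewrite -[x]lprojK projN projD addNr. Qed.

HB.instance Definition _ := GRing.isZmodule.Build lquot addA addC add0 addN.

Let scaleA c d x : scale c (scale d x) = scale (c * d) x.
Proof. by rewrite -[x]lprojK !projZ scalerA. Qed.

Let scale1 x : scale 1 x = x.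
Proof. by rewrite -[x]lprojK !projZ scale1r. Qed.

Let scaleDr c x y : scale c (x + y) = scale c x + scale c y.
Proof.
by rewrite -[x]lprojK -[y]lprojK [_ + _]projD !projZ [RHS]projD scalerDr.
Qed.

Let scaleDl x c d : scale (c + d) x = scale c x + scale d x.
Proof. by rewrite -[x]lprojK !projZ [RHS]projD scalerDl. Qed.

HB.instance Definition _ :=
  GRing.Zmodule_isLmodule.Build F lquot scaleA scale1 scaleDr scaleDl.

Lemma lproj_is_linear : linear lproj.
Proof. by move=> c x y; rewrite -projD -projZ. Qed.

HB.instance Definition _ :=
  GRing.isLinear.Build F V lquot _ lproj lproj_is_linear.

End LinearQuotient.

Section IdealQuotient.
Variables (F : fieldType) (R : comAlgType F) (S : R -> Prop).

(* The ideal generated by S is the linear span of the multiples of S.    *)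
Definition multiples (z : R) : Prop := exists r s, S s /\ z = r * s.
Definition ideal : R -> Prop := lspan multiples.

Lemma idealM r x : ideal x -> ideal (r * x).
Proof.
move=> [s [Ss ->]]; exists [seq (y.1, r * y.2) | y <- s]; split.
  move=> _ /mapP[y ys ->]; have [t [e [Se ye]]] := Ss y ys.
  by exists (r * t), e; split; rewrite //= ye mulrA.
by rewrite big_map mulr_sumr; apply: eq_bigr => y _; rewrite scalerAr.
Qed.

Lemma ideal_sub x : S x -> ideal x.
Proof. by move=> Sx; apply: lspan_sub; exists 1, x; rewrite mul1r. Qed.

Lemma ideal_ker (T : comNzRingType) (f : R -> T) :
    zmod_morphism f -> monoid_morphism f -> (forall s, S s -> f s = 0) ->
  forall x, ideal x -> f x = 0.
Proof.
move=> fB [f1 fM] fS x; case=> s [Ss ->].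
have f0 : f 0 = 0 by have := fB 0 0; rewrite !subrr.
have fN y : f (- y) = - f y by rewrite -[- y]sub0r fB f0 sub0r.
have fD y z : f (y + z) = f y + f z by have := fB y (- z); rewrite opprK fN opprK.
elim: s Ss => [|y s IHs] Ss; first by rewrite big_nil.
rewrite big_cons fD IHs ?addr0; last by move=> z zs; apply: Ss; rewrite inE zs orbT.
have [r [e [Se ->]]] : multiples y.2 by apply: Ss; rewrite inE eqxx.
by rewrite -mulr_algl !fM (fS e Se) !mulr0.
Qed.

Lemma ideal_proper (T : comNzRingType) (f : R -> T) :
    zmod_morphism f -> monoid_morphism f -> (forall s, S s -> f s = 0) ->
  ~ ideal 1.
Proof.
move=> fB fM fS /(ideal_ker fB fM fS); rewrite fM.1.
by move/eqP; rewrite oner_eq0.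
Qed.

(* Properness is required because comAlgType excludes the zero ring.     *)
Definition iquot (proper : ~ ideal 1) := lquot multiples.

Variable proper : ~ ideal 1.
Local Notation Q := (iquot proper).

HB.instance Definition _ := GRing.Lmodule.on Q.

Definition iproj (x : R) : Q := @lproj F R multiples x.

Lemma iproj_is_linear : linear iproj.
Proof. exact: (@lproj_is_linear F R multiples). Qed.

HB.instance Definition _ := GRing.isLinear.Build F R Q _ iproj iproj_is_linear.

Lemma iprojP x y : iproj x = iproj y <-> ideal (x - y).
Proof. exact: lprojP. Qed.

Lemma iprojK (x : Q) : iproj (repr (x : lquot multiples)) = x.
Proof. exact: reprK. Qed.

Let one : Q := iproj 1.
Let mul (x y : Q) : Q :=
  iproj (repr (x : lquot multiples) * repr (y : lquot multiples)).

Let projM x y : mul (iproj x) (iproj y) = iproj (x * y).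
Proof.
apply/iprojP; set x' := repr _; set y' := repr _.
have -> : x' * y' - x * y = y' * (x' - x) + x * (y' - y).
  by rewrite mulrBr mulrBr [y' * x']mulrC [y' * x]mulrC addrA subrK.
by apply: lspanD; apply/idealM/lspan_repr.
Qed.

Let mulA : associative mul.
Proof.
by move=> x y z; rewrite -[x]iprojK -[y]iprojK -[z]iprojK !projM mulrA.
Qed.

Let mulC : commutative mul.
Proof. by move=> x y; rewrite -[x]iprojK -[y]iprojK !projM mulrC. Qed.

Let mul1 : left_id one mul.
Proof. by move=> x; rewrite -[x]iprojK projM mul1r. Qed.

Let mulDl : left_distributive mul +%R.
Proof.
move=> x y z; rewrite -[x]iprojK -[y]iprojK -[z]iprojK.
by rewrite -[_ + _]raddfD !projM -[RHS]raddfD mulrDl.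
Qed.

Let oner_neq0 : one != 0.
Proof.
apply/eqP; rewrite -[0](raddf0 iproj) => /iprojP.
by rewrite subr0.
Qed.

HB.instance Definition _ :=
  GRing.Zmodule_isComNzRing.Build Q mulA mulC mul1 mulDl oner_neq0.

Let scaleAl (c : F) (x y : Q) : c *: (x * y) = (c *: x) * y.
Proof.
rewrite -[x]iprojK -[y]iprojK [_ * _]projM -!linearZ.
by rewrite [RHS]projM scalerAl.
Qed.

HB.instance Definition _ := GRing.Lmodule_isLalgebra.Build F Q scaleAl.
HB.instance Definition _ := GRing.Lalgebra_isComAlgebra.Build F Q.

Lemma iproj_is_monoid_morphism : monoid_morphism iproj.
Proof. by split=> // x y; rewrite -[RHS]projM. Qed.

HB.instance Definition _ :=
  GRing.isMonoidMorphism.Build R Q iproj iproj_is_monoid_morphism.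

End IdealQuotient.

Section FreeGroup.
Variable I : choiceType.

(* The letter (i, false) stands for i and (i, true) for its inverse.     *)
Definition letter : choiceType := (I * bool)%type.
Definition linv (x : letter) : letter := (x.1, ~~ x.2).
Definition winv (w : seq letter) : seq letter := rev (map linv w).

Inductive free_eq : seq letter -> seq letter -> Prop :=
| free_cancel w1 w2 x : free_eq (w1 ++ [:: x; linv x] ++ w2) (w1 ++ w2)
| free_refl w : free_eq w w
| free_sym w1 w2 : free_eq w1 w2 -> free_eq w2 w1
| free_trans w1 w2 w3 : free_eq w1 w2 -> free_eq w2 w3 -> free_eq w1 w3.

Lemma linvK : involutive linv.
Proof. by case=> i b; rewrite /linv negbK. Qed.

Lemma free_eqM w1 w1' w2 w2' :
  free_eq w1 w1' -> free_eq w2 w2' -> free_eq (w1 ++ w2) (w1' ++ w2').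
Proof.
move=> e1 e2; apply: (@free_trans _ (w1' ++ w2)).
  elim: e1 => [a b x|a|a b _|a b c _ eab _ ebc].
  - by rewrite -!catA; exact: free_cancel.
  - exact: free_refl.
  - exact: free_sym.
  - exact: free_trans eab ebc.
elim: e2 => [a b x|a|a b _|a b c _ eab _ ebc].
- by rewrite !catA -[_ ++ [:: _; _]]catA -!catA catA [X in free_eq _ X]catA;
    exact: free_cancel.
- exact: free_refl.
- exact: free_sym.
- exact: free_trans eab ebc.
Qed.

Lemma free_eqV w w' : free_eq w w' -> free_eq (winv w) (winv w').
Proof.
elim=> [a b x|a|a b _|a b c _ eab _ ebc].
- rewrite /winv !map_cat !rev_cat -catA /= linvK; exact: free_cancel.
- exact: free_refl.
- exact: free_sym.
- exact: free_trans eab ebc.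
Qed.

Lemma free_mulV w : free_eq (winv w ++ w) [::].
Proof.
elim: w => [|x w IHw]; first exact: free_refl.
rewrite /winv map_cons rev_cons cat_rcons.
rewrite -[_ ++ _]/(winv w ++ [:: linv x; x] ++ w).
apply: free_trans IHw; rewrite -{2}[x]linvK; exact: free_cancel.
Qed.

Definition free_eqb w1 w2 : bool := `[< free_eq w1 w2 >].

Lemma free_eqb_is_equiv : equiv_class_of free_eqb.
Proof.
split=> [x|x y|y x z].
- by apply/asboolP; exact: free_refl.
- by apply/asboolP/asboolP => /free_sym.
by move=> /asboolP xy /asboolP yz; apply/asboolP; exact: free_trans xy yz.
Qed.

Canonical free_eqb_equiv := EquivRelPack free_eqb_is_equiv.
Canonical free_eqb_encModRel := defaultEncModRel free_eqb.

Definition free_group := {eq_quot free_eqb}.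

HB.instance Definition _ : EqQuotient (seq letter) free_eqb free_group :=
  EqQuotient.on free_group.
HB.instance Definition _ := Choice.on free_group.

Definition fword (w : seq letter) : free_group := \pi_free_group w.

Lemma fwordP w1 w2 : fword w1 = fword w2 <-> free_eq w1 w2.
Proof.
split=> [/eqP|e]; first by rewrite /fword piE => /asboolP.
by apply/eqP; rewrite /fword piE; apply/asboolP.
Qed.

Lemma fwordK (g : free_group) : fword (repr g) = g.
Proof. exact: reprK. Qed.

Definition fone := fword [::].
Definition fmul (g h : free_group) := fword (repr g ++ repr h).
Definition finv (g : free_group) := fword (winv (repr g)).

Lemma fmul_word w1 w2 : fmul (fword w1) (fword w2) = fword (w1 ++ w2).
Proof. by apply/fwordP/free_eqM; apply/fwordP; rewrite fwordK. Qed.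

Lemma finv_word w : finv (fword w) = fword (winv w).
Proof. by apply/fwordP/free_eqV/fwordP; rewrite fwordK. Qed.

Lemma fmulA : associative fmul.
Proof.
by move=> x y z; rewrite -[x]fwordK -[y]fwordK -[z]fwordK !fmul_word catA.
Qed.

Lemma fmul1 : left_id fone fmul.
Proof. by move=> x; rewrite -[x]fwordK fmul_word. Qed.

Lemma fmulr1 : right_id fone fmul.
Proof. by move=> x; rewrite -[x]fwordK fmul_word cats0. Qed.

Lemma fmulV : left_inverse fone finv fmul.
Proof.
by move=> x; rewrite -[x]fwordK finv_word fmul_word; apply/fwordP/free_mulV.
Qed.

Lemma fmulrV : right_inverse fone finv fmul.
Proof.
move=> x; rewrite -[LHS]fmul1 -{1}(fmulV (finv x)) -!fmulA.
by rewrite [fmul (finv x) _]fmulA fmulV fmul1 fmulV.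
Qed.

HB.instance Definition _ :=
  isGroup.Build free_group fmulA fmul1 fmulr1 fmulV fmulrV.

Definition fgen (i : I) : free_group := fword [:: (i, false)].

End FreeGroup.

(* Finitely supported functions G -> F. The ring structure of monalg is
   not available here: it excludes monoids with nontrivial units.        *)
Definition galg (F : fieldType) (G : groupType) : Type := {malg F[G]}.

HB.lock Definition gel (F : fieldType) (G : groupType) (g : G) : galg F G :=
  << 1 *g g >> : {malg F[G]}.

(* Linear extension of a map defined on the basis G. Like gel and
   gmul, it is locked so that unification does not compute in A.         *)
HB.lock Definition glin (F : fieldType) (G : groupType) (V : lmodType F)
    (f : G -> V) (x : galg F G) : V :=
  \sum_(g <- msupp (x : {malg F[G]})) mcoeff g x *: f g.
Arguments glin {F G V} f x.

Section GroupAlgebra.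
Variables (F : fieldType) (G : groupType).
Local Notation A := (galg F G).
Local Notation gel := (@gel F G).

HB.instance Definition _ := Choice.on A.
HB.instance Definition _ := GRing.Lmodule.on A.

Lemma glinE (V : lmodType F) (f : G -> V) (x : A) :
  glin f x = \sum_(g <- msupp x) x@_g *: f g.
Proof. by rewrite glin.unlock. Qed.

Lemma glinEw (V : lmodType F) (f : G -> V) (x : A) (d : {fset G}) :
  fsubset (msupp x) d -> glin f x = \sum_(g <- d) x@_g *: f g.
Proof.
move=> le; rewrite glin.unlock (big_fset_incl _ le) //= => g _ /mcoeff_outdom ->.
by rewrite scale0r.
Qed.

Lemma glin_is_linear (V : lmodType F) (f : G -> V) : linear (glin f).
Proof.
move=> c x y; pose d := fsetU (msupp x) (msupp y).
have lx : fsubset (msupp x) d by exact: fsubsetUl.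
have ly : fsubset (msupp y) d by exact: fsubsetUr.
have lz : fsubset (msupp (c *: x + y)) d.
  apply: (fsubset_trans (msuppD_le _ _)).
  by rewrite fsubUset ly andbT (fsubset_trans (msuppZ_le _ _)).
rewrite (glinEw _ lx) (glinEw _ ly) (glinEw _ lz) scaler_sumr -big_split /=.
by apply: eq_bigr => g _; rewrite mcoeffD mcoeffZ scalerDl scalerA.
Qed.

HB.instance Definition _ (V : lmodType F) (f : G -> V) :=
  GRing.isLinear.Build F A V _ (glin f) (glin_is_linear f).

Lemma glin_gel (V : lmodType F) (f : G -> V) g : glin f (gel g) = f g.
Proof.
rewrite gel.unlock (glinEw _ (msuppU_le : fsubset _ [fset g]%fset)).
by rewrite big_seq_fset1 mcoeffUU scale1r.
Qed.

Lemma galgE (x : A) : x = \sum_(g <- msupp x) x@_g *: gel g.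
Proof.
rewrite {1}[x]monalgE; apply: eq_bigr => g _; apply/malgP => k.
by rewrite mcoeffZ gel.unlock !mcoeffU mulrnAr mulr1.
Qed.

Lemma galg_ext (V : lmodType F) (f1 f2 : A -> V) :
  linear f1 -> linear f2 -> (forall g, f1 (gel g) = f2 (gel g)) -> f1 =1 f2.
Proof.
have fE (f : A -> V) : linear f -> f =1 glin (f \o gel).
  move=> lf x; rewrite {1}[x]galgE.
  have f0 : f 0 = 0 by have := lf (-1) 0 0; rewrite !scaleN1r oppr0 addr0 addNr.
  have fD y z : f (y + z) = f y + f z by have := lf 1 y z; rewrite !scale1r.
  rewrite (big_morph f fD f0) glin.unlock; apply: eq_bigr => g _.
  by have := lf x@_g (gel g) 0; rewrite f0 !addr0.
move=> l1 l2 e x; rewrite fE // [RHS]fE //.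
by rewrite !glin.unlock; apply: eq_bigr => g _; rewrite /= e.
Qed.

End GroupAlgebra.

HB.lock Definition gmul (F : fieldType) (G : groupType) (x y : galg F G) :
  galg F G := glin (fun g => glin (fun h => gel F (g * h)%g) y) x.

Section GroupAlgebraRing.
Variables (F : fieldType) (G : groupType).
Local Notation A := (galg F G).
Local Notation gel := (@gel F G).
Local Notation gmul := (@gmul F G).

Definition gone : A := gel 1%g.

Lemma gmul_linl y : linear (gmul^~ y).
Proof. by move=> c a b; rewrite !gmul.unlock linearP. Qed.

Lemma gmul_linr x : linear (gmul x).
Proof.
move=> c y z; rewrite !gmul.unlock ![glin _ x]glinE scaler_sumr -big_split /=.
by apply: eq_bigr => g _; rewrite linearP scalerDr !scalerA [c * _]mulrC.
Qed.

Lemma gmul_gel g h : gmul (gel g) (gel h) = gel (g * h)%g.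
Proof. by rewrite !gmul.unlock !glin_gel. Qed.

Lemma gmulA : associative gmul.
Proof.
move=> x y z; move: x; apply: galg_ext.
- exact: gmul_linl.
- by move=> c a b; rewrite gmul_linl gmul_linl.
move=> g; move: y; apply: galg_ext.
- by move=> c a b; rewrite gmul_linl gmul_linr.
- by move=> c a b; rewrite gmul_linr gmul_linl.
move=> h; move: z; apply: galg_ext.
- by move=> c a b; rewrite !gmul_linr.
- exact: gmul_linr.
by move=> k; rewrite !gmul_gel mulgA.
Qed.

Lemma gmul1g : left_id gone gmul.
Proof.
apply: galg_ext; [exact: gmul_linr | by [] | move=> g].
by rewrite gmul_gel mul1g.
Qed.

Lemma gmulg1 : right_id gone gmul.
Proof.
apply: galg_ext; [exact: gmul_linl | by [] | move=> g].
by rewrite gmul_gel mulg1.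
Qed.

Lemma gmulDl : left_distributive gmul +%R.
Proof. by move=> x y z; rewrite -[x in LHS]scale1r gmul_linl scale1r. Qed.

Lemma gmulDr : right_distributive gmul +%R.
Proof. by move=> x y z; rewrite -[y in LHS]scale1r gmul_linr scale1r. Qed.

Lemma gone_neq0 : gone != 0.
Proof.
apply/eqP => /(congr1 (mcoeff 1%g)) /eqP.
by rewrite /gone gel.unlock mcoeffUU mcoeff0 oner_eq0.
Qed.

HB.instance Definition _ := GRing.Zmodule_isNzRing.Build A
  gmulA gmul1g gmulg1 gmulDl gmulDr gone_neq0.

Let scaleAl (c : F) (x y : A) : c *: (x * y) = (c *: x) * y.
Proof. by have := gmul_linl y c x 0; rewrite !addr0 [gmul 0 _](mul0r y) addr0. Qed.

HB.instance Definition _ := GRing.Lmodule_isLalgebra.Build F A scaleAl.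

Let scaleAr (c : F) (x y : A) : c *: (x * y) = x * (c *: y).
Proof. by have := gmul_linr x c y 0; rewrite !addr0 [gmul _ 0](mulr0 x) addr0. Qed.

HB.instance Definition _ := GRing.Lalgebra_isAlgebra.Build F A scaleAr.

Lemma gelM g h : gel (g * h)%g = gel g * gel h.
Proof. exact/esym/gmul_gel. Qed.

Lemma gel1 : gel 1%g = 1.
Proof. by []. Qed.

End GroupAlgebraRing.

Reserved Notation "a \ox b" (at level 45, no associativity).

(* A (x) A for A = F[G], as the group algebra of G x G. With the          *)
(* componentwise product, both bimodule structures of A (x) A are         *)
(* multiplications by elements of A (x) 1 and 1 (x) A.                    *)

Section Tensor.
Variables (F : fieldType) (G : groupType).
Local Notation A := (galg F G).
Local Notation AA := (galg F (G * G)%type).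

Definition tens (a b : A) : AA :=
  glin (fun g => glin (fun h => gel F (g, h)) b) a.
Local Notation "a \ox b" := (tens a b) : ring_scope.

Definition swap : AA -> AA := glin (fun g => gel F (g.2, g.1)).
Definition mult : AA -> A := glin (fun g => gel F (g.1 * g.2)%g).
Definition outer (a : A) (d : AA) (b : A) : AA := (a \ox 1) * d * (1 \ox b).
Definition inner (a : A) (d : AA) (b : A) : AA := (1 \ox a) * d * (b \ox 1).

(* Inversion on G, extended linearly: for the free group on u, v this is
   the anti-automorphism phi with phi(u) = u^-1 and phi(v) = v^-1.       *)
Definition ginv : A -> A := glin (fun g => gel F g^-1%g).

HB.instance Definition _ := GRing.Linear.on swap.
HB.instance Definition _ := GRing.Linear.on mult.
HB.instance Definition _ := GRing.Linear.on ginv.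

Lemma tens_linl b : linear (tens^~ b).
Proof. exact: glin_is_linear. Qed.

Lemma tens_linr a : linear (tens a).
Proof.
move=> c y z; rewrite /tens ![glin _ a]glinE scaler_sumr -big_split /=.
by apply: eq_bigr => g _; rewrite linearP scalerDr !scalerA [c * _]mulrC.
Qed.

Lemma tens_gel g h : gel F g \ox gel F h = gel F (g, h).
Proof. by rewrite /tens !glin_gel. Qed.

Lemma galg_ind2 (V : lmodType F) (f1 f2 : A -> A -> V) :
    (forall b, linear (f1^~ b)) -> (forall a, linear (f1 a)) ->
    (forall b, linear (f2^~ b)) -> (forall a, linear (f2 a)) ->
    (forall g h, f1 (gel F g) (gel F h) = f2 (gel F g) (gel F h)) ->
  forall a b, f1 a b = f2 a b.
Proof.
move=> l1 r1 l2 r2 e a b; apply: (galg_ext (l1 b) (l2 b)) => g.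
exact: (galg_ext (r1 _) (r2 _)).
Qed.

Lemma tens_ext (V : lmodType F) (f1 f2 : AA -> V) :
  linear f1 -> linear f2 -> (forall a b, f1 (a \ox b) = f2 (a \ox b)) ->
  f1 =1 f2.
Proof.
by move=> l1 l2 e; apply: galg_ext => // -[g h]; rewrite -tens_gel.
Qed.

Lemma tensM a b c d : (a \ox b) * (c \ox d) = (a * c) \ox (b * d).
Proof.
move: a b; apply: galg_ind2 => [b|a|b|a|g h]; try move=> k x y.
- by rewrite tens_linl mulrDl scalerAl.
- by rewrite tens_linr mulrDl scalerAl.
- by rewrite mulrDl -scalerAl tens_linl.
- by rewrite mulrDl -scalerAl tens_linr.
move: c d; apply: galg_ind2 => [b|a|b|a|g' h']; try move=> k x y.
- by rewrite tens_linl mulrDr scalerAr.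
- by rewrite tens_linr mulrDr scalerAr.
- by rewrite mulrDr -scalerAr tens_linl.
- by rewrite mulrDr -scalerAr tens_linr.
by rewrite !tens_gel -!gelM tens_gel.
Qed.

Lemma outer_tens a b c d : outer a (c \ox d) b = (a * c) \ox (d * b).
Proof. by rewrite /outer !tensM mul1r mulr1. Qed.

Lemma inner_tens a b c d : inner a (c \ox d) b = (c * b) \ox (a * d).
Proof. by rewrite /inner !tensM mul1r mulr1. Qed.

Lemma swap_tens a b : swap (a \ox b) = b \ox a.
Proof.
move: a b; apply: galg_ind2 => [b|a|b|a|g h]; try move=> k x y.
- by rewrite tens_linl linearP.
- by rewrite tens_linr linearP.
- by rewrite tens_linr.
- by rewrite tens_linl.
by rewrite !tens_gel /swap glin_gel.
Qed.

Lemma mult_tens a b : mult (a \ox b) = a * b.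
Proof.
move: a b; apply: galg_ind2 => [b|a|b|a|g h]; try move=> k x y.
- by rewrite tens_linl linearP.
- by rewrite tens_linr linearP.
- by rewrite mulrDl scalerAl.
- by rewrite mulrDr scalerAr.
by rewrite tens_gel /mult glin_gel gelM.
Qed.

Lemma ginv_gel g : ginv (gel F g) = gel F g^-1%g.
Proof. exact: glin_gel. Qed.

Lemma ginvM a b : ginv (a * b) = ginv b * ginv a.
Proof.
move: a b; apply: galg_ind2 => [b|a|b|a|g h]; try move=> k x y.
- by rewrite mulrDl -scalerAl linearP.
- by rewrite mulrDr -scalerAr linearP.
- by rewrite linearP mulrDr scalerAr.
- by rewrite linearP mulrDl scalerAl.
by rewrite -gelM !ginv_gel -gelM invgM.
Qed.

Lemma ginvK : involutive ginv.
Proof.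
apply: galg_ext => [c x y|//|g]; first by rewrite !linearP.
by rewrite !ginv_gel invgK.
Qed.

Definition double_bracket (br : A -> A -> AA) : Prop :=
  [/\ (forall b, linear (br^~ b)) /\ (forall a, linear (br a)),
      forall a b, br a b = - swap (br b a),
      forall a b c, br a (b * c) = outer 1 (br a b) c + outer b (br a c) 1 &
      forall a b c, br (b * c) a = inner 1 (br b a) c + inner b (br c a) 1].

Definition commutator (z : A) : Prop := exists a b, z = a * b - b * a.

Local Notation commquot := (lquot commutator).
Definition cls : A -> lquot commutator := @lproj F A commutator.

HB.instance Definition _ := GRing.Linear.on cls.

Definition sharp (br : A -> A -> AA) (x y : commquot) : commquot :=
  cls (mult (br (repr x) (repr y))).

Lemma mult_outer a b d : mult (outer a d b) = a * mult d * b.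
Proof.
move: d; apply: tens_ext => [c x y|c x y|x y].
- by rewrite /outer mulrDr mulrDl -scalerAr -scalerAl linearP.
- by rewrite linearP mulrDr mulrDl -scalerAr -scalerAl.
by rewrite outer_tens !mult_tens !mulrA.
Qed.

Lemma mult_inner_sym a d : mult (inner 1 d a) = mult (inner a d 1).
Proof.
move: d; apply: tens_ext => [c x y|c x y|x y].
- by rewrite /inner mulrDr mulrDl -scalerAr -scalerAl linearP.
- by rewrite /inner mulrDr mulrDl -scalerAr -scalerAl linearP.
by rewrite !inner_tens !mult_tens mul1r mulr1 mulrA.
Qed.

Lemma lspan_lin (V : lmodType F) (S : V -> Prop) (f : {linear V -> V})
    (T : V -> Prop) :
  (forall s, S s -> lspan T (f s)) -> forall z, lspan S z -> lspan T (f z).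
Proof.
move=> fS z [s [Ss ->]]; elim: s Ss => [|x s IHs] Ss.
  by rewrite big_nil raddf0; exact: lspan0.
rewrite big_cons linearP; apply: lspanD.
  by apply/lspanZ/fS/Ss; rewrite inE eqxx.
by apply: IHs => y ys; apply: Ss; rewrite inE ys orbT.
Qed.

(* m o {{-,-}} descends to A/[A,A].                                     *)
Lemma sharp_cls (br : A -> A -> AA) : double_bracket br ->
  forall a b, sharp br (cls a) (cls b) = cls (mult (br a b)).
Proof.
move=> [[brl0 brr0] _ brMr brMl] a b.
have brl c k x y : br (k *: x + y) c = k *: br x c + br y c by exact: brl0.
have brr c k x y : br c (k *: x + y) = k *: br c x + br c y by exact: brr0.
have multD x y : mult (x + y) = mult x + mult y by exact: raddfD.
have multN x : mult (- x) = - mult x by exact: raddfN.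
have comm0 x y : lspan commutator (x * y - y * x).
  by apply: lspan_sub; exists x, y.
have killl c z : lspan commutator z -> mult (br z c) = 0.
  move=> [s [Ss ->]]; elim: s Ss => [|x s IHs] Ss.
    rewrite big_nil; have := brl c (-1) 0 0.
    by rewrite !scaleN1r oppr0 addr0 addNr => ->; rewrite raddf0.
  rewrite big_cons brl linearP /= IHs ?addr0; last first.
    by move=> y ys; apply: Ss; rewrite inE ys orbT.
  have [|y [z' ->]] := Ss x _; first by rewrite inE eqxx.
  have := brl c (-1) (z' * y) (y * z').
  rewrite scaleN1r addrC => ->; rewrite scaleN1r !brMl.
  rewrite multD multN 2!multD !mult_inner_sym.
  by rewrite [X in - X + _]addrC addNr scaler0.
have killr c z : lspan commutator z -> lspan commutator (mult (br c z)).
  move=> [s [Ss ->]]; elim: s Ss => [|x s IHs] Ss.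
    rewrite big_nil; have := brr c (-1) 0 0.
    rewrite !scaleN1r oppr0 addr0 addNr => ->; rewrite raddf0; exact: lspan0.
  rewrite big_cons brr linearP /=; apply: lspanD; last first.
    by apply: IHs => y ys; apply: Ss; rewrite inE ys orbT.
  apply: lspanZ; have [|y [z' ->]] := Ss x _; first by rewrite inE eqxx.
  have := brr c (-1) (z' * y) (y * z').
  rewrite scaleN1r addrC => ->; rewrite scaleN1r !brMr.
  rewrite multD multN 2!multD !mult_outer !mul1r !mulr1.
  set p := mult _; set q := mult _.
  have -> : - (p * y + z' * q) + (q * z' + y * p)
          = (q * z' - z' * q) + (y * p - p * y).
    by rewrite opprD addrC [- (p * y) - _]addrC addrACA.
  exact: lspanD.
apply/lprojP.
set a' := repr _; set b' := repr _.
have da : lspan commutator (a' - a) by exact: lspan_repr.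
have db : lspan commutator (b' - b) by exact: lspan_repr.
have -> : br a' b' = br (a' - a) b' + br a (b' - b) + br a b.
  rewrite -addrA; have := brl b' 1 (a' - a) a; rewrite !scale1r subrK => ->.
  by have := brr a 1 (b' - b) b; rewrite !scale1r subrK => <-.
by rewrite !raddfD /= addrK killl // add0r; exact: killr.
Qed.

Definition augm : A -> F := glin (fun _ => 1 : F^o).

Lemma augm_zmod : zmod_morphism augm.
Proof. by move=> x y; rewrite /augm raddfB. Qed.

Lemma augm_gel g : augm (gel F g) = 1.
Proof. by rewrite /augm glin_gel. Qed.

Lemma augm_lin : linear (augm : A -> F^o).
Proof. exact: glin_is_linear. Qed.

Lemma augm_linE c a b : augm (c *: a + b) = c * augm a + augm b.
Proof. exact: augm_lin. Qed.

Lemma augm_monoid : monoid_morphism augm.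
Proof.
split=> [|a b]; first exact: augm_gel.
move: a b; apply: (@galg_ind2 (F^o : lmodType F)) => [b|a|b|a|g h]; try move=> k x y.
- by rewrite mulrDl -scalerAl augm_lin.
- by rewrite mulrDr -scalerAr augm_lin.
- by rewrite augm_lin mulrDl scalerAl.
- by rewrite augm_lin mulrDr scalerAr.
by rewrite -gelM !augm_gel mulr1.
Qed.

Lemma augm_ginv a : augm (ginv a) = augm a.
Proof.
move: a; apply: (@galg_ext _ _ (F^o : lmodType F)) => [k x y|k x y|g].
- by rewrite linearP augm_lin.
- exact: augm_lin.
by rewrite ginv_gel !augm_gel.
Qed.

End Tensor.

Notation "a \ox b" := (tens a b) : ring_scope.

Section Laurent.
Variable F : fieldType.

Definition laurent := galg F (free_group bool).

Definition gu : free_group bool := fgen false.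
Definition gv : free_group bool := fgen true.
Definition u : laurent := gel F gu.
Definition v : laurent := gel F gv.
Definition u' : laurent := gel F gu^-1%g.
Definition v' : laurent := gel F gv^-1%g.

Lemma laurent_unit : [/\ u * u' = 1, u' * u = 1, v * v' = 1 & v' * v = 1].
Proof. by split; rewrite -gelM ?mulgV ?mulVg. Qed.

Definition laurent_bracket
    (br : laurent -> laurent -> galg F (free_group bool * free_group bool)%type)
    : Prop :=
  [/\ double_bracket br,
      br v v = 2^-1 *: (v ^+ 2 \ox 1 - 1 \ox v ^+ 2),
      br u u = - 2^-1 *: (u ^+ 2 \ox 1 - 1 \ox u ^+ 2) &
      br v u = 2^-1 *: (u * v \ox 1 + 1 \ox v * u - v \ox u + u \ox v)].

Definition phi : laurent -> laurent := @ginv F (free_group bool).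

Lemma phi_anti_involution :
  [/\ linear phi, phi 1 = 1, {morph phi : a b / a * b >-> b * a} & involutive phi].
Proof.
split; [exact: linearP | | exact: ginvM | exact: ginvK].
by rewrite -gel1 /phi ginv_gel invg1.
Qed.

Lemma phi_gen : phi u = u' /\ phi v = v'.
Proof. by split; exact: ginv_gel. Qed.

Definition ham (lambda : F) : laurent :=
  u + v + u' + v' + lambda *: (u' * v' + v * u).

End Laurent.

Arguments u {F}.
Arguments v {F}.
Arguments u' {F}.
Arguments v' {F}.

(* Polynomials in the symbols a_ij, for a in A.                          *)
Definition rep_poly (F : fieldType) (G : groupType) (N : nat) :=
  {malg F[{cmonom (galg F G * 'I_N * 'I_N)%type}]}.

HB.lock Definition rep_var (F : fieldType) (G : groupType) (N : nat)
    (a : galg F G) (i j : 'I_N) : rep_poly F G N := << ucm (a, i, j) >>.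

Section RepSpace.
Variables (F : fieldType) (G : groupType) (N : nat).
Local Notation A := (galg F G).

Local Notation rep_poly := (rep_poly F G N).

Inductive rep_rel : rep_poly -> Prop :=
| rep_rel_lin c a b i j :
    rep_rel (rep_var (c *: a + b) i j - (c *: rep_var a i j + rep_var b i j))
| rep_rel_mul a b i j :
    rep_rel (rep_var (a * b) i j - \sum_r rep_var a i r * rep_var b r j)
| rep_rel_one i j : rep_rel (rep_var 1 i j - (i == j)%:R).

(* The point of Rep(A, N) sending G to the identity matrix.              *)
Definition rep_mono_eval (m : {cmonom (A * 'I_N * 'I_N)%type}) : F :=
  \prod_(x <- finsupp m) (augm x.1.1 *+ (x.1.2 == x.2)) ^+ m x.

Lemma rep_mono_eval_mmorphism : mmorphism rep_mono_eval.
Proof.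
have evalw (m : {cmonom (A * 'I_N * 'I_N)%type})
    (d : {fset (A * 'I_N * 'I_N)%type}) : fsubset (finsupp m) d ->
    rep_mono_eval m = \prod_(x <- d) (augm x.1.1 *+ (x.1.2 == x.2)) ^+ m x.
  move=> le; rewrite /rep_mono_eval (big_fset_incl _ le) //= => x _.
  by rewrite -cmE_eq0 => /eqP->; rewrite expr0.
split=> [m1 m2|]; last by rewrite /rep_mono_eval mdom1 big_seq_fset0.
rewrite (evalw (mmul m1 m2) _ (fsubset_refl _)) mdomD.
rewrite (evalw m1 _ (fsubsetUl _ (finsupp m2))).
rewrite (evalw m2 _ (fsubsetUr (finsupp m1) _)) -big_split /=.
by apply: eq_bigr => x _; rewrite cmM exprD.
Qed.

HB.instance Definition _ :=
  isMultiplicative.Build _ _ rep_mono_eval rep_mono_eval_mmorphism.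

Definition rep_eval : rep_poly -> F := mmap idfun rep_mono_eval.

Lemma rep_eval_var a i j : rep_eval (rep_var a i j) = augm a *+ (i == j).
Proof.
rewrite /rep_eval rep_var.unlock mmapU mul1r /= /rep_mono_eval mdomU big_seq_fset1.
by rewrite cmUU expr1.
Qed.

Lemma rep_eval_zmod : zmod_morphism rep_eval.
Proof. exact: raddfB. Qed.

Lemma rep_eval_monoid : monoid_morphism rep_eval.
Proof. by split; [exact: rmorph1 | exact: rmorphM]. Qed.

Lemma rep_evalD x y : rep_eval (x + y) = rep_eval x + rep_eval y.
Proof. exact: raddfD. Qed.

Lemma rep_evalM x y : rep_eval (x * y) = rep_eval x * rep_eval y.
Proof. exact: rmorphM. Qed.

Lemma rep_evalZ c x : rep_eval (c *: x) = c * rep_eval x.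
Proof. by rewrite -mul_malgC rep_evalM /rep_eval mmapC. Qed.

Lemma rep_eval_rel x : rep_rel x -> rep_eval x = 0.
Proof.
case=> [c a b i j|a b i j|i j]; rewrite rep_eval_zmod rep_eval_var.
- rewrite rep_evalD rep_evalZ !rep_eval_var augm_linE mulrnDl mulrnAr.
  exact: subrr.
- rewrite (big_morph rep_eval rep_evalD (raddf0 _)) (bigD1 i) //=.
  rewrite big1 => [|r ri]; last first.
    by rewrite rep_evalM rep_eval_var [i == r]eq_sym (negbTE ri) mul0r.
  by rewrite rep_evalM !rep_eval_var eqxx addr0 (augm_monoid _ _).2 mulrnAr subrr.
by rewrite (augm_monoid _ _).1 /rep_eval rmorph_nat subrr.
Qed.

Lemma rep_proper : ~ ideal rep_rel 1.
Proof. exact: (ideal_proper rep_eval_zmod rep_eval_monoid rep_eval_rel). Qed.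

Definition rep_ring := iquot rep_proper.

Definition repX (a : A) : 'M[rep_ring]_N :=
  \matrix_(i, j) iproj rep_proper (rep_var a i j).

(* tau = id and sgn = 1 is the orthogonal type; see symplectic_twist for *)
(* the symplectic type.                                                  *)
Record twist := Twist {
  tau : 'I_N -> 'I_N;
  sgn : 'I_N -> F;
  tau_inj : injective tau;
  sgn_sq : forall i, sgn i * sgn i = 1 }.

Variables (t : twist).

Inductive twisted_rel : rep_ring -> Prop :=
| TwistedRel a i j :
    twisted_rel
      (repX (ginv a) i j - (sgn t i * sgn t j) *: repX a (tau t j) (tau t i)).

Definition rep_ring_eval (x : rep_ring) : F :=
  rep_eval (repr (x : lquot (multiples rep_rel))).

Lemma rep_ring_evalE x : rep_ring_eval (iproj rep_proper x) = rep_eval x.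
Proof.
apply/eqP; rewrite -subr_eq0 -rep_eval_zmod; apply/eqP.
apply: (ideal_ker rep_eval_zmod rep_eval_monoid rep_eval_rel).
exact: lspan_repr.
Qed.

Lemma rep_ring_eval_zmod : zmod_morphism rep_ring_eval.
Proof.
move=> x y; rewrite -[x]iprojK -[y]iprojK -raddfB !rep_ring_evalE.
exact: rep_eval_zmod.
Qed.

Lemma rep_ring_eval_monoid : monoid_morphism rep_ring_eval.
Proof.
split=> [|x y]; first by rewrite -(rmorph1 (iproj rep_proper)) rep_ring_evalE rep_eval_monoid.1.
rewrite -[x]iprojK -[y]iprojK -rmorphM !rep_ring_evalE.
exact: rep_eval_monoid.2.
Qed.

Lemma twisted_eval x : twisted_rel x -> rep_ring_eval x = 0.
Proof.
case=> a i j; rewrite !mxE -linearZ -raddfB rep_ring_evalE rep_eval_zmod.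
rewrite rep_evalZ !rep_eval_var augm_ginv (inj_eq (@tau_inj t)) [j == i]eq_sym.
have [->|_] := eqVneq i j; last by rewrite !mulr0n mulr0 subrr.
by rewrite sgn_sq mul1r subrr.
Qed.

Lemma twisted_proper : ~ ideal twisted_rel 1.
Proof.
exact: (ideal_proper rep_ring_eval_zmod rep_ring_eval_monoid twisted_eval).
Qed.

Definition twisted_ring := iquot twisted_proper.

Definition twistedX (a : A) : 'M[twisted_ring]_N :=
  map_mx (iproj twisted_proper) (repX a).

Local Notation AA := (galg F (G * G)%type).

(* (c (x) d)_{kj,il} = c_kj d_il, extended linearly to A (x) A           *)
Definition tens_entry (Q : comAlgType F) (X : A -> 'M[Q]_N) (d : AA)
    (k j i l : 'I_N) : Q :=
  glin (fun g => X (gel F g.1) k j * X (gel F g.2) i l) d.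

Definition biderivation (Q : comAlgType F) (br : Q -> Q -> Q) : Prop :=
  [/\ (forall y, linear (br^~ y)) /\ (forall x, linear (br x)),
      forall x y, br x y = - br y x,
      forall x y z, br x (y * z) = br x y * z + y * br x z &
      forall x y z, br (x * y) z = br x z * y + x * br y z].

Definition rep_bracket (dbr : A -> A -> AA) (br : rep_ring -> rep_ring -> rep_ring)
    : Prop :=
  biderivation br /\
  forall a b i j k l,
    br (repX a i j) (repX b k l) = tens_entry repX (dbr a b) k j i l.

Definition twisted_bracket (dbr : A -> A -> AA)
    (br : twisted_ring -> twisted_ring -> twisted_ring) : Prop :=
  biderivation br /\
  forall a b i j k l,
    br (twistedX a i j) (twistedX b k l) =
      2^-1 *: tens_entry twistedX (dbr a b) k j i l +
      (2^-1 * (sgn t i * sgn t j)) *: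
        tens_entry twistedX (dbr (ginv a) b) k (tau t i) (tau t j) l.

End RepSpace.

Definition orthogonal_twist (F : fieldType) (N : nat) : twist F N :=
  @Twist F N id (fun=> 1) (@inj_id _) (fun=> mulr1 1).

Section Symplectic.
Variables (F : fieldType) (n : nat).

Definition symplectic_tau (k : 'I_(n + n)) : 'I_(n + n) :=
  match split k with inl i => rshift n i | inr i => lshift n i end.

Definition symplectic_sgn (k : 'I_(n + n)) : F := if (k < n)%N then 1 else -1.

Lemma symplectic_tau_inj : injective symplectic_tau.
Proof.
apply: (can_inj (g := symplectic_tau)) => k; rewrite -[k]splitK.
rewrite /symplectic_tau unsplitK; case: (split k) => i.
  by rewrite (unsplitK (inr i)).
by rewrite (unsplitK (inl i)).
Qed.

Lemma symplectic_sgn_sq k : symplectic_sgn k * symplectic_sgn k = 1.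
Proof. by rewrite /symplectic_sgn; case: ifP; rewrite ?mulrNN mulr1. Qed.

Definition symplectic_twist : twist F (n + n) :=
  Twist symplectic_tau_inj symplectic_sgn_sq.

End Symplectic.

(* Hamilton's equations for tr(h_lambda) on a representation space, the
   matrix first integral X(v u v^-1 u^-1), and the commuting first
   integrals tr(h_lambda^m). The bracket br is on the coordinate ring Q,
   and X is the matrix (a_ij) of coordinate functions.                   *)
Definition rep_first_integrals (F : fieldType) (N : nat) (lambda : F)
    (Q : comAlgType F) (X : laurent F -> 'M[Q]_N) (br : Q -> Q -> Q) : Prop :=
  let h := ham lambda in
  let ddt (f : Q) := br (\tr (X h)) f in
  [/\ map_mx ddt (X u) =
        X u *m X v - X u *m X v' - lambda%:A *: X v'
        + lambda%:A *: (X u *m X v *m X u) /\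
      map_mx ddt (X v) =
        X v *m X u' - X v *m X u + lambda%:A *: X u'
        - lambda%:A *: (X v *m X u *m X v),
      map_mx ddt (X (v * u * v' * u')) = 0,
      forall m, (0 < m)%N -> ddt (\tr (X (h ^+ m))) = 0 &
      forall m k, (0 < m)%N -> (0 < k)%N ->
        br (\tr (X (h ^+ m))) (\tr (X (h ^+ k))) = 0].

(* Main.v *)
(** With x = u + v^-1 + lambda u^-1 v^-1 and a suitable z in A,
      {{h, h}} = x (x) h - h (x) x + z (x) 1 - 1 (x) z.
    Hence m o {{h^m, h}} = m ([x, h^m] + [z, h^(m-1)]), and by the derivation
    property m o {{h^m, h^k}} is, modulo [A, A], the product of this element by
    k h^(k-1), that is, a sum of commutators. On representation spaces
    {tr a, X(b)} = X(m o {{a, b}}), also for the twisted brackets when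
    phi(a) = a, so everything follows from the statements in A. The identities
    in A and A (x) A are checked by computation with linear combinations of
    words in the free group. *)

Require Import Defs.
From mathcomp Require Import all_boot all_algebra reals complex.

Set Implicit Arguments.
Unset Strict Implicit.
Unset Printing Implicit Defensive.

Import GRing.Theory.
Local Open Scope ring_scope.

Section LinearCombinations.
Variables (F : fieldType) (lambda : F).

(* The entry (z, n, k) stands for z * lambda ^ n times the vector of index k. *)
Definition comb (K : Type) := seq (int * nat * K).

Definition lcomb (K : Type) (V : lmodType F) (f : K -> V) (s : comb K) : V :=
  \sum_(t <- s) (t.1.1%:~R * lambda ^+ t.1.2) *: f t.2.

Definition scalec (K : Type) (z : int) (n : nat) (s : comb K) : comb K :=
  [seq (z * t.1.1, (n + t.1.2)%N, t.2) | t <- s].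

Definition mapc (K K' : Type) (g : K -> K') (s : comb K) : comb K' :=
  [seq (t.1, g t.2) | t <- s].

Definition bindc (K K' : Type) (g : K -> comb K') (s : comb K) : comb K' :=
  flatten [seq scalec t.1.1 t.1.2 (g t.2) | t <- s].

Definition bind2c (K K' K'' : Type) (g : K -> K' -> comb K'')
    (s : comb K) (s' : comb K') : comb K'' :=
  bindc (fun k => bindc (g k) s') s.

Fixpoint insertc (K : eqType) (t : int * nat * K) (s : comb K) : comb K :=
  if s is x :: s' then
    if (x.1.2 == t.1.2) && (x.2 == t.2) then
      if x.1.1 + t.1.1 == 0 then s' else (x.1.1 + t.1.1, x.1.2, x.2) :: s'
    else x :: insertc t s'
  else [:: t].

Definition collectc (K : eqType) (s : comb K) : comb K := foldr (@insertc K) [::] s.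

Section Values.
Variables (K : Type) (V : lmodType F) (f : K -> V).

Lemma lcomb_nil : lcomb f [::] = 0.
Proof. exact: big_nil. Qed.

Lemma lcomb_cons t s :
  lcomb f (t :: s) = (t.1.1%:~R * lambda ^+ t.1.2) *: f t.2 + lcomb f s.
Proof. exact: big_cons. Qed.

Lemma lcomb_cat s s' : lcomb f (s ++ s') = lcomb f s + lcomb f s'.
Proof. exact: big_cat. Qed.

Lemma lcomb_scale z n s :
  lcomb f (scalec z n s) = (z%:~R * lambda ^+ n) *: lcomb f s.
Proof.
rewrite /lcomb big_map scaler_sumr; apply: eq_bigr => t _ /=.
by rewrite scalerA rmorphM exprD mulrACA.
Qed.

Lemma lcomb_opp s : lcomb f (scalec (-1) 0 s) = - lcomb f s.
Proof. by rewrite lcomb_scale expr0 mulr1 rmorphN1 scaleN1r. Qed.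

Lemma lcomb_dbl s : lcomb f (scalec 2 0 s) = 2 *: lcomb f s.
Proof. by rewrite lcomb_scale expr0 mulr1. Qed.

Lemma lcomb1 k : lcomb f [:: (1, 0%N, k)] = f k.
Proof. by rewrite lcomb_cons lcomb_nil addr0 expr0 mulr1 scale1r. Qed.

End Values.

Lemma lcomb_insert (K : eqType) (V : lmodType F) (f : K -> V) t s :
  lcomb f (insertc t s) = lcomb f (t :: s).
Proof.
elim: s => //= x s IHs; case: ifP => [/andP[/eqP en /eqP ek]|_]; last first.
  by rewrite lcomb_cons IHs !lcomb_cons addrCA.
case: eqP => [e|_]; rewrite !lcomb_cons /= -en -ek addrA -scalerDl -mulrDl.
  by rewrite -rmorphD /= [t.1.1 + _]addrC e mul0r scale0r add0r.
by rewrite -[in RHS]intrD [in RHS](addrC t.1.1).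
Qed.

Lemma lcomb_collect (K : eqType) (V : lmodType F) (f : K -> V) s :
  lcomb f (collectc s) = lcomb f s.
Proof. by elim: s => //= t s IHs; rewrite lcomb_insert !lcomb_cons IHs. Qed.

Lemma lcomb_map (K K' : Type) (V : lmodType F) (f' : K' -> V) (g : K -> K') s :
  lcomb f' (mapc g s) = lcomb (f' \o g) s.
Proof. by rewrite /lcomb big_map. Qed.

Lemma eq_lcomb (K : Type) (V : lmodType F) (f f' : K -> V) s :
  f =1 f' -> lcomb f s = lcomb f' s.
Proof. by move=> e; apply: eq_bigr => t _; rewrite e. Qed.

Lemma linear_map0 (U V : lmodType F) (L : U -> V) : linear L -> L 0 = 0.
Proof. by move=> lL; have := lL (-1) 0 0; rewrite !scaleN1r oppr0 addr0 addNr. Qed.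

Lemma linear_lcomb (K : Type) (U V : lmodType F) (L : U -> V) (f : K -> U) s :
  linear L -> L (lcomb f s) = lcomb (L \o f) s.
Proof.
move=> lL; elim: s => [|t s IHs]; first by rewrite !lcomb_nil linear_map0.
by rewrite !lcomb_cons lL IHs.
Qed.

Lemma lcomb_bind (K K' : Type) (U V : lmodType F) (L : U -> V)
    (f : K -> U) (f' : K' -> V) (g : K -> comb K') s :
    linear L -> (forall k, L (f k) = lcomb f' (g k)) ->
  L (lcomb f s) = lcomb f' (bindc g s).
Proof.
move=> lL e; rewrite linear_lcomb //; elim: s => [|t s IHs].
  by rewrite !lcomb_nil.
by rewrite lcomb_cons /bindc /= lcomb_cat -/(bindc g s) -IHs lcomb_scale -e.
Qed.

Lemma lcomb_bind2 (K K' K'' : Type) (U U' V : lmodType F) (B : U -> U' -> V)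
    (f : K -> U) (f' : K' -> U') (f'' : K'' -> V) (g : K -> K' -> comb K'') s s' :
    (forall y, linear (B^~ y)) -> (forall x, linear (B x)) ->
    (forall k k', B (f k) (f' k') = lcomb f'' (g k k')) ->
  B (lcomb f s) (lcomb f' s') = lcomb f'' (bind2c g s s').
Proof.
move=> lB rB e; apply: (@lcomb_bind _ _ _ _ (B^~ (lcomb f' s'))) => // k.
exact: lcomb_bind.
Qed.

End LinearCombinations.

Section Words.

Definition word := seq (letter bool).

Definition cons_reduce (x : letter bool) (w : word) : word :=
  if w is y :: w' then if y == linv x then w' else x :: w else [:: x].

Definition reduce (w : word) : word := foldr cons_reduce [::] w.

Lemma fword_cons (x : letter bool) (w : word) : fword (x :: w) = (fword [:: x] * fword w)%g.
Proof. by rewrite [RHS]fmul_word. Qed.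

Lemma fword_reduce w : fword (reduce w) = fword w.
Proof.
elim: w => //= x w IHw; rewrite fword_cons -IHw -fword_cons.
case: (reduce w) => //= y w'; case: eqP => // ->.
by apply/esym/fwordP; exact: (@free_cancel _ [::] w').
Qed.

Definition reduce2 (p : word * word) := (reduce p.1, reduce p.2).

Definition outerw (a b : word) (p : word * word) := (a ++ p.1, p.2 ++ b).
Definition innerw (a b : word) (p : word * word) := (p.1 ++ b, a ++ p.2).

(* Twice the double bracket of the generators; false is u and true is v. *)
Definition gen_bracket (i j : bool) : comb (word * word) :=
  let U := (false, false) in let V := (true, false) in
  match i, j with
  | true, true => [:: (1, 0%N, ([:: V; V], [::])); (-1, 0%N, ([::], [:: V; V]))]
  | false, false => [:: (-1, 0%N, ([:: U; U], [::])); (1, 0%N, ([::], [:: U; U]))]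
  | true, false => [:: (1, 0%N, ([:: U; V], [::])); (1, 0%N, ([::], [:: V; U]));
                       (-1, 0%N, ([:: V], [:: U])); (1, 0%N, ([:: U], [:: V]))]
  | false, true => [:: (-1, 0%N, ([::], [:: U; V])); (-1, 0%N, ([:: V; U], [::]));
                       (1, 0%N, ([:: U], [:: V])); (-1, 0%N, ([:: V], [:: U]))]
  end.

Definition letter_bracket (x y : letter bool) : comb (word * word) :=
  let s := gen_bracket x.1 y.1 in
  let s := if y.2 then scalec (-1) 0 (mapc (outerw [:: y] [:: y]) s) else s in
  if x.2 then scalec (-1) 0 (mapc (innerw [:: x] [:: x]) s) else s.

Fixpoint letter_word_bracket x (w : word) : comb (word * word) :=
  if w is y :: w' then
    mapc (outerw [::] w') (letter_bracket x y) ++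
    mapc (outerw [:: y] [::]) (letter_word_bracket x w')
  else [::].

Fixpoint word_bracket (w1 w2 : word) : comb (word * word) :=
  if w1 is x :: w' then
    mapc (innerw [::] w') (letter_word_bracket x w2) ++
    mapc (innerw [:: x] [::]) (word_bracket w' w2)
  else [::].

End Words.

Section DoubleBracket.
Variables (F : fieldType) (G : groupType).
Local Notation A := (galg F G).
Local Notation AA := (galg F (G * G)%type).
Implicit Types (a b c : A) (d : AA).

Lemma tens11 : (1 : A) \ox (1 : A) = 1 :> AA.
Proof. exact: tens_gel. Qed.

Lemma outer_lin a b : linear (fun d => outer a d b).
Proof. by move=> k x y; rewrite /outer mulrDr mulrDl -scalerAr -scalerAl. Qed.

Lemma inner_lin a b : linear (fun d => inner a d b).
Proof. by move=> k x y; rewrite /inner mulrDr mulrDl -scalerAr -scalerAl. Qed.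

Lemma outerZ k a d b : outer a (k *: d) b = k *: outer a d b.
Proof. by rewrite /outer -scalerAr -scalerAl. Qed.

Lemma innerZ k a d b : inner a (k *: d) b = k *: inner a d b.
Proof. by rewrite /inner -scalerAr -scalerAl. Qed.

Lemma outer1 d : outer 1 d 1 = d.
Proof. by rewrite /outer tens11 mul1r mulr1. Qed.

Lemma inner1 d : inner 1 d 1 = d.
Proof. by rewrite /inner tens11 mul1r mulr1. Qed.

Lemma outer_outer a b a' b' d : outer a (outer a' d b') b = outer (a * a') d (b' * b).
Proof.
move: d; apply: tens_ext => [k x y|k x y|x y]; try by rewrite !outer_lin.
by rewrite !outer_tens !mulrA.
Qed.

Lemma inner_inner a b a' b' d : inner a (inner a' d b') b = inner (a * a') d (b' * b).
Proof.
move: d; apply: tens_ext => [k x y|k x y|x y]; try by rewrite !inner_lin.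
by rewrite !inner_tens !mulrA.
Qed.

Variable br : A -> A -> AA.
Hypothesis brP : double_bracket br.

Lemma bracket_linl b : linear (br^~ b).
Proof. by have [[l _] _ _ _] := brP. Qed.

Lemma bracket_linr a : linear (br a).
Proof. by have [[_ r] _ _ _] := brP. Qed.

Lemma bracket1r a : br a 1 = 0.
Proof.
have [_ _ brM _] := brP; apply: (@addrI _ (br a 1)).
by have := brM a 1 1; rewrite mulr1 !outer1 addr0.
Qed.

Lemma bracket1l a : br 1 a = 0.
Proof.
have [_ _ _ brM] := brP; apply: (@addrI _ (br 1 a)).
by have := brM a 1 1; rewrite mulr1 !inner1 addr0.
Qed.

Lemma bracketVr a b b' : b' * b = 1 -> b * b' = 1 ->
  br a b' = - outer b' (br a b) b'.
Proof.
have [_ _ brM _] := brP => bl bb; apply/eqP; rewrite -addr_eq0; apply/eqP.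
have := congr1 (fun d => outer b' d 1) (brM a b b').
rewrite bb bracket1r (linear_map0 (outer_lin _ _)) -[outer 1 _ _ + _]scale1r.
rewrite scalerDr !scale1r => /esym.
rewrite -[outer 1 _ _ in X in X -> _]scale1r outer_lin scale1r !outer_outer.
by rewrite !mulr1 bl outer1 addrC.
Qed.

Lemma bracketVl a b b' : b' * b = 1 -> b * b' = 1 ->
  br b' a = - inner b' (br b a) b'.
Proof.
have [_ _ _ brM] := brP => bl bb; apply/eqP; rewrite -addr_eq0; apply/eqP.
have := congr1 (fun d => inner b' d 1) (brM a b b').
rewrite bb bracket1l (linear_map0 (inner_lin _ _)) => /esym.
rewrite -[inner 1 _ _ in X in X -> _]scale1r inner_lin scale1r !inner_inner.
by rewrite !mulr1 bl inner1 addrC.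
Qed.

End DoubleBracket.

Inductive lexp :=
  | Letter of letter bool
  | Lam of lexp
  | Opp of lexp
  | Add of lexp & lexp
  | Mul of lexp & lexp.

Fixpoint lexp_comb (e : lexp) : comb word :=
  match e with
  | Letter x => [:: (1, 0%N, [:: x])]
  | Lam e => scalec 1 1 (lexp_comb e)
  | Opp e => scalec (-1) 0 (lexp_comb e)
  | Add e e' => lexp_comb e ++ lexp_comb e'
  | Mul e e' => bind2c (fun w w' => [:: (1, 0%N, w ++ w')]) (lexp_comb e) (lexp_comb e')
  end.

Section LaurentBracket.
Variables (F : fieldType) (lambda : F).
Local Notation A := (laurent F).
Local Notation AA := (galg F (free_group bool * free_group bool)%type).

Definition wordA (w : word) : A := gel F (fword w).
Definition wordAA (p : word * word) : AA := gel F (fword p.1, fword p.2).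

Lemma wordA_cat w w' : wordA (w ++ w') = wordA w * wordA w'.
Proof. by rewrite /wordA -gelM -fmul_word. Qed.

Lemma wordAAE p : wordAA p = wordA p.1 \ox wordA p.2.
Proof. by rewrite tens_gel. Qed.

Lemma lcomb_reduce s : lcomb lambda wordA (mapc reduce s) = lcomb lambda wordA s.
Proof. by rewrite lcomb_map; apply: eq_lcomb => w /=; rewrite /wordA fword_reduce. Qed.

Lemma lcomb_reduce2 s :
  lcomb lambda wordAA (mapc reduce2 s) = lcomb lambda wordAA s.
Proof. by rewrite lcomb_map; apply: eq_lcomb => w /=; rewrite /wordAA !fword_reduce. Qed.

Lemma lcomb_wordA_eq s s' :
  collectc (mapc reduce (s ++ scalec (-1) 0 s')) = [::] ->
  lcomb lambda wordA s = lcomb lambda wordA s'.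
Proof.
move=> e; apply/eqP; rewrite -subr_eq0 -lcomb_opp -lcomb_cat -lcomb_reduce.
by rewrite -lcomb_collect e lcomb_nil.
Qed.

Lemma lcomb_wordAA_eq s s' :
  collectc (mapc reduce2 (s ++ scalec (-1) 0 s')) = [::] ->
  lcomb lambda wordAA s = lcomb lambda wordAA s'.
Proof.
move=> e; apply/eqP; rewrite -subr_eq0 -lcomb_opp -lcomb_cat -lcomb_reduce2.
by rewrite -lcomb_collect e lcomb_nil.
Qed.

Lemma mult_lcomb s :
  mult (lcomb lambda wordAA s) = lcomb lambda wordA (mapc (fun p => p.1 ++ p.2) s).
Proof.
rewrite linear_lcomb; last exact: linearP.
rewrite lcomb_map; apply: eq_lcomb => p /=.
by rewrite wordAAE mult_tens wordA_cat.
Qed.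

Lemma tens_lcomb s s' :
  lcomb lambda wordA s \ox lcomb lambda wordA s' =
  lcomb lambda wordAA (bind2c (fun w w' => [:: (1, 0%N, (w, w'))]) s s').
Proof.
apply: lcomb_bind2 => [b|a|w w']; [exact: tens_linl | exact: tens_linr |].
by rewrite lcomb1 wordAAE.
Qed.

Lemma outer_lcomb a b s :
  outer (wordA a) (lcomb lambda wordAA s) (wordA b) =
  lcomb lambda wordAA (mapc (outerw a b) s).
Proof.
rewrite (linear_lcomb _ _ _ (outer_lin _ _)) lcomb_map; apply: eq_lcomb => p /=.
by rewrite !wordAAE outer_tens !wordA_cat.
Qed.

Lemma inner_lcomb a b s :
  inner (wordA a) (lcomb lambda wordAA s) (wordA b) =
  lcomb lambda wordAA (mapc (innerw a b) s).
Proof.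
rewrite (linear_lcomb _ _ _ (inner_lin _ _)) lcomb_map; apply: eq_lcomb => p /=.
by rewrite !wordAAE inner_tens !wordA_cat.
Qed.

Fixpoint lexp_value (e : lexp) : A :=
  match e with
  | Letter (false, false) => u
  | Letter (false, true) => u'
  | Letter (true, false) => v
  | Letter (true, true) => v'
  | Lam e => lambda *: lexp_value e
  | Opp e => - lexp_value e
  | Add e e' => lexp_value e + lexp_value e'
  | Mul e e' => lexp_value e * lexp_value e'
  end.

Lemma lexp_valueE e : lexp_value e = lcomb lambda wordA (lexp_comb e).
Proof.
elim: e => [x|e /= ->|e /= ->|e /= -> e' ->|e /= -> e' ->].
- rewrite lcomb1 /wordA; case: x => -[] [] //=.
  + by rewrite /v' [(_^-1)%g]finv_word.
  + by rewrite /u' [(_^-1)%g]finv_word.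
- by rewrite lcomb_scale mul1r expr1.
- by rewrite lcomb_opp.
- by rewrite lcomb_cat.
apply: lcomb_bind2 => [b k x y|a k x y|w w'].
- by rewrite mulrDl scalerAl.
- by rewrite mulrDr scalerAr.
by rewrite lcomb1 wordA_cat.
Qed.

Hypothesis two_neq0 : 2 != 0 :> F.
Variable br : A -> A -> AA.
Hypothesis brP : laurent_bracket br.

Let dbrP : double_bracket br. Proof. by have [] := brP. Qed.

Let halfK (V : lmodType F) (x : V) : 2 *: (2^-1 *: x) = x.
Proof. by rewrite scalerA divff // scale1r. Qed.

Lemma gen_bracketE i j :
  2 *: br (wordA [:: (i, false)]) (wordA [:: (j, false)]) =
  lcomb lambda wordAA (gen_bracket i j).
Proof.
have [_ bvv buu bvu] := brP; have [_ brN _ _] := dbrP.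
have -> : wordA [:: (i, false)] = if i then v else u by case: i.
have -> : wordA [:: (j, false)] = if j then v else u by case: j.
have c1 p s : lcomb lambda wordAA ((1, 0%N, p) :: s) =
    wordA p.1 \ox wordA p.2 + lcomb lambda wordAA s.
  by rewrite lcomb_cons mulr1 scale1r wordAAE.
have c2 p s : lcomb lambda wordAA ((-1, 0%N, p) :: s) =
    - (wordA p.1 \ox wordA p.2) + lcomb lambda wordAA s.
  by rewrite lcomb_cons mulr1 scaleN1r wordAAE.
have uE : wordA [:: (false, false)] = u by [].
have vE : wordA [:: (true, false)] = v by [].
have oneE : wordA [::] = 1 by [].
have pE x y : wordA [:: x; y] = wordA [:: x] * wordA [:: y] by rewrite -wordA_cat.
have bvu2 : 2 *: br v u = u * v \ox 1 + 1 \ox v * u - v \ox u + u \ox v.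
  by rewrite bvu halfK.
case: i; case: j; rewrite /= !(c1, c2) lcomb_nil addr0 /= ?pE ?uE ?vE ?oneE.
- by rewrite bvv halfK.
- by rewrite bvu2 !addrA.
- rewrite brN scalerN -linearZ bvu2 !linearD linearN /= !swap_tens.
  by rewrite opprK !addrA.
- by rewrite buu scaleNr scalerN halfK opprB addrC.
Qed.

Lemma letter_bracketE x y :
  2 *: br (wordA [:: x]) (wordA [:: y]) = lcomb lambda wordAA (letter_bracket x y).
Proof.
have wV i : wordA [:: (i, true)] * wordA [:: (i, false)] = 1 /\
            wordA [:: (i, false)] * wordA [:: (i, true)] = 1.
  split; rewrite -wordA_cat /wordA; congr (gel F _); apply/fwordP.
    exact: (@free_cancel _ [::] [::] (i, true)).
  exact: (@free_cancel _ [::] [::] (i, false)).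
have yE i : 2 *: br (wordA [:: (i, false)]) (wordA [:: y]) =
    lcomb lambda wordAA (letter_bracket (i, false) y).
  case: y => j [] /=; last exact: gen_bracketE.
  have [e1 e2] := wV j; rewrite (bracketVr dbrP _ e1 e2) scalerN.
  rewrite /letter_bracket /= lcomb_opp -outer_lcomb -gen_bracketE.
  by rewrite outerZ.
case: x => i [] /=; last exact: yE.
have [e1 e2] := wV i; rewrite (bracketVl dbrP _ e1 e2) scalerN.
rewrite [letter_bracket _ _]/(scalec _ _ (mapc _ (letter_bracket (i, false) y))).
rewrite lcomb_opp -inner_lcomb -yE.
by rewrite innerZ.
Qed.

Lemma letter_word_bracketE x w :
  2 *: br (wordA [:: x]) (wordA w) = lcomb lambda wordAA (letter_word_bracket x w).
Proof.
have [_ _ brM _] := dbrP.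
elim: w => [|y w IHw] /=; first by rewrite bracket1r // scaler0 lcomb_nil.
rewrite lcomb_cat -!outer_lcomb -IHw -letter_bracketE.
rewrite -[y :: w]/([:: y] ++ w) wordA_cat brM scalerDr.
by congr (_ + _); rewrite outerZ.
Qed.

Lemma word_bracketE w1 w2 :
  2 *: br (wordA w1) (wordA w2) = lcomb lambda wordAA (word_bracket w1 w2).
Proof.
have [_ _ _ brM] := dbrP.
elim: w1 => [|x w IHw] /=; first by rewrite bracket1l // scaler0 lcomb_nil.
rewrite lcomb_cat -!inner_lcomb -IHw -letter_word_bracketE.
rewrite -[x :: w]/([:: x] ++ w) wordA_cat brM scalerDr.
by congr (_ + _); rewrite innerZ.
Qed.

Lemma bracket_lcomb s s' :
  2 *: br (lcomb lambda wordA s) (lcomb lambda wordA s') =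
  lcomb lambda wordAA (bind2c word_bracket s s').
Proof.
apply: (@lcomb_bind2 _ _ _ _ _ _ _ _ (fun x y => 2 *: br x y)).
- by move=> b k x y; rewrite (bracket_linl dbrP) scalerDr !scalerA mulrC.
- by move=> b k x y; rewrite (bracket_linr dbrP) scalerDr !scalerA mulrC.
exact: word_bracketE.
Qed.

End LaurentBracket.

Section Commutators.
Variables (F : fieldType) (G : groupType).
Local Notation A := (galg F G).
Local Notation AA := (galg F (G * G)%type).
Implicit Types (a b c x y : A) (d : AA).

Lemma cls_mulC a b : cls (a * b) = cls (b * a).
Proof. by apply/lprojP/lspan_sub; exists a, b. Qed.

Lemma mult_inner_lin a b : linear (fun d => mult (inner a d b)).
Proof. by move=> k x y; rewrite inner_lin linearP. Qed.

Lemma mult_inner_inner a b c d :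
  mult (inner 1 (inner a d b) c) = mult (inner 1 d (b * c * a)).
Proof.
move: d; apply: tens_ext => [k x y|k x y|x y].
- by rewrite inner_lin mult_inner_lin.
- by rewrite mult_inner_lin.
by rewrite !inner_tens !mult_tens !mul1r !mulrA.
Qed.

Variable br : A -> A -> AA.
Hypothesis brP : double_bracket br.

Lemma mult_bracketM a b c :
  mult (br a (b * c)) = mult (br a b) * c + b * mult (br a c).
Proof.
by have [_ _ brM _] := brP; rewrite brM raddfD /= !mult_outer mul1r mulr1.
Qed.

Lemma mult_bracket_expl a b m :
  mult (br (a ^+ m.+1) b) = mult (inner 1 (br a b) (a ^+ m)) *+ m.+1.
Proof.
have [_ _ _ brM] := brP.
suff IH n c : GRing.comm c a -> mult (inner 1 (br (a ^+ n) b) c) =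
    mult (inner 1 (br a b) (a ^+ n.-1 * c)) *+ n.
  by have := IH m.+1 1 (commr_sym (commr1 a)); rewrite inner1 mulr1.
elim: n c => [|n IHn] c ca.
  by rewrite expr0 (bracket1l brP) (linear_map0 (mult_inner_lin _ _)) mulr0n.
rewrite exprS brM -[X in inner 1 X c]scale1r scalerDr !scale1r.
rewrite -[inner 1 _ _ in X in inner 1 X c]scale1r mult_inner_lin scale1r.
rewrite !mult_inner_inner mul1r mulr1 IHn; last by rewrite /GRing.comm mulrA -ca.
rewrite mulrS; congr (_ + _).
case: n {IHn} => [|n]; first by rewrite !mulr0n.
by rewrite ca mulrA -exprSr.
Qed.

Lemma cls_mult_bracket_expr a b k :
  cls (mult (br a (b ^+ k.+1))) = cls (b ^+ k * mult (br a b)) *+ k.+1.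
Proof.
suff IH j n : cls (b ^+ j * mult (br a (b ^+ n))) =
    cls (b ^+ (j + n.-1) * mult (br a b)) *+ n.
  by have := IH 0%N k.+1; rewrite mul1r.
elim: n j => [|n IHn] j.
  by rewrite expr0 (bracket1r brP) raddf0 mulr0 raddf0 mulr0n.
rewrite exprS mult_bracketM mulrDr raddfD /= [b ^+ j * (b * _)]mulrA -exprSr IHn.
rewrite [b ^+ j * _]mulrA cls_mulC mulrA -exprD addnC mulrS; congr (_ + _).
case: n {IHn} => [|n]; first by rewrite !mulr0n.
by rewrite addSn addnS.
Qed.

(* Inserting p = h^m between the tensor factors turns x (x) h - h (x) x into
   [x, h p] and z (x) 1 - 1 (x) z into [z, p]. *)
Lemma involutive_powers h x z :
    br h h = x \ox h - h \ox x + (z \ox 1 - 1 \ox z) ->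
  forall m k, cls (mult (br (h ^+ m.+1) (h ^+ k.+1))) = 0.
Proof.
move=> e m k; rewrite cls_mult_bracket_expr mult_bracket_expl e mulrnAr raddfMn /=.
have mi a b : mult (inner 1 (a \ox b) (h ^+ m)) = a * h ^+ m * b.
  by rewrite inner_tens mult_tens mul1r.
have miD (d d' : AA) : mult (inner 1 (d + d') (h ^+ m)) =
    mult (inner 1 d (h ^+ m)) + mult (inner 1 d' (h ^+ m)).
  by have := mult_inner_lin 1 (h ^+ m) 1 d d'; rewrite !scale1r.
have miN (d : AA) : mult (inner 1 (- d) (h ^+ m)) = - mult (inner 1 d (h ^+ m)).
  by rewrite -scaleN1r innerZ scaleN1r raddfN.
rewrite !miD !miN !mi mul1r mulr1 !mulrDr !mulrN !raddfD !raddfN /=.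
have -> : cls (h ^+ k * (x * h ^+ m * h)) = cls (h ^+ k * (h * h ^+ m * x)).
  rewrite -mulrA -exprSr -exprS !mulrA cls_mulC !mulrA -!exprD addnC.
  by rewrite cls_mulC.
have -> : cls (h ^+ k * (z * h ^+ m)) = cls (h ^+ k * (h ^+ m * z)).
  by rewrite mulrA cls_mulC !mulrA -!exprD addnC.
by rewrite !subrr addr0 !mul0rn.
Qed.

End Commutators.

Section HamiltonianFlow.
Variables (F : fieldType) (lambda : F).
Hypothesis two_neq0 : 2 != 0 :> F.
Local Notation A := (laurent F).
Local Notation AA := (galg F (free_group bool * free_group bool)%type).
Variable br : A -> A -> AA.
Hypothesis brP : laurent_bracket br.

Let dbrP : double_bracket br. Proof. by have [] := brP. Qed.

Let Lu := Letter (false, false).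
Let Lu' := Letter (false, true).
Let Lv := Letter (true, false).
Let Lv' := Letter (true, true).
Let Lh := Add (Add (Add (Add Lu Lv) Lu') Lv') (Lam (Add (Mul Lu' Lv') (Mul Lv Lu))).

Let hE : ham lambda = lexp_value lambda Lh. Proof. by []. Qed.

Let scale2I (V : lmodType F) (x y : V) : 2 *: x = 2 *: y -> x = y.
Proof. exact: scalerI. Qed.

Lemma mult_bracket_lexp e e' e'' :
    collectc (mapc reduce (mapc (fun p => p.1 ++ p.2)
        (bind2c word_bracket (lexp_comb e) (lexp_comb e')) ++
      scalec (-1) 0 (scalec 2 0 (lexp_comb e'')))) = [::] ->
  mult (br (lexp_value lambda e) (lexp_value lambda e')) = lexp_value lambda e''.
Proof.
move=> chk; apply: scale2I; rewrite -linearZ !lexp_valueE bracket_lcomb //.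
by rewrite [LHS]mult_lcomb -lcomb_dbl; apply: lcomb_wordA_eq.
Qed.

Lemma flow_u :
  mult (br (ham lambda) u) = u * v - u * v' - lambda *: v' + lambda *: (u * v * u).
Proof.
apply: (mult_bracket_lexp (e := Lh) (e' := Lu)
  (e'' := Add (Add (Add (Mul Lu Lv) (Opp (Mul Lu Lv'))) (Opp (Lam Lv')))
              (Lam (Mul (Mul Lu Lv) Lu)))).
by vm_compute.
Qed.

Lemma flow_v :
  mult (br (ham lambda) v) = v * u' - v * u + lambda *: u' - lambda *: (v * u * v).
Proof.
apply: (mult_bracket_lexp (e := Lh) (e' := Lv)
  (e'' := Add (Add (Add (Mul Lv Lu') (Opp (Mul Lv Lu))) (Lam Lu'))
              (Opp (Lam (Mul (Mul Lv Lu) Lv))))).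
by vm_compute.
Qed.

Lemma flow_commutator : mult (br (ham lambda) (v * u * v' * u')) = 0.
Proof.
have -> : 0 = lexp_value lambda (Add Lu (Opp Lu)) by rewrite /= subrr.
apply: (mult_bracket_lexp (e := Lh) (e' := Mul (Mul (Mul Lv Lu) Lv') Lu')).
by vm_compute.
Qed.

Lemma bracket_ham : exists z, let x := u + v' + lambda *: (u' * v') in
  br (ham lambda) (ham lambda) =
  x \ox ham lambda - ham lambda \ox x + (z \ox 1 - 1 \ox z).
Proof.
pose Sub e e' := Add e (Opp e'); pose C e e' := Sub (Mul e e') (Mul e' e).
pose Lx := Add (Add Lu Lv') (Lam (Mul Lu' Lv')).
pose Ly := Add (Add Lv Lu') (Lam (Mul Lv Lu)).
pose Lz := Add (Sub (Mul Ly Ly) (Mul Lx Lx))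
  (Add (Add (C Lu Ly) (C Lu' Lx)) (Lam (C Lv (Mul (Sub Lu' Lu) Lv')))).
exists (2^-1 *: lexp_value lambda Lz); cbv zeta; apply: scale2I.
rewrite -[u + v' + _]/(lexp_value lambda Lx) hE.
have tZl a b c : (a *: b) \ox c = a *: (b \ox c) :> AA.
  by have := tens_linl c a b 0; rewrite !addr0 (linear_map0 (tens_linl c)) addr0.
have tZr a b c : b \ox (a *: c) = a *: (b \ox c) :> AA.
  by have := tens_linr b a c 0; rewrite !addr0 (linear_map0 (tens_linr b)) addr0.
rewrite tZl tZr -scalerBr scalerDr scalerA divff // scale1r.
have -> : 1 = lcomb lambda (@wordA F) [:: (1, 0%N, [::])] by rewrite lcomb1.
rewrite !lexp_valueE bracket_lcomb // !tens_lcomb -!lcomb_opp -!lcomb_cat.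
rewrite -lcomb_dbl -lcomb_cat; apply: lcomb_wordAA_eq.
by vm_compute.
Qed.

Lemma phi_ham : phi (ham lambda) = ham lambda.
Proof.
have [phiu phiv] := phi_gen F; have [_ _ phiM phiK] := phi_anti_involution F.
have [phiu' phiv'] : phi u' = u :> A /\ phi v' = v :> A.
  by rewrite -phiu -phiv !phiK.
have phiD x y : phi (x + y) = phi x + phi y :> A by exact: raddfD.
have phiZ c x : phi (c *: x) = c *: phi x :> A by exact: linearZ.
rewrite /ham !phiD phiZ phiD !phiM phiu phiv phiu' phiv' [v * u + _]addrC.
by congr (_ + _); rewrite -addrA addrC addrA.
Qed.

Lemma phi_ham_exp m : phi (ham lambda ^+ m) = ham lambda ^+ m.
Proof.
have [_ phi1 phiM _] := phi_anti_involution F.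
by elim: m => [|m IHm]; rewrite ?phi1 // {1}exprS phiM IHm phi_ham -exprSr.
Qed.

Lemma involutive_ham m k :
  cls (mult (br (ham lambda ^+ m.+1) (ham lambda ^+ k.+1))) = 0.
Proof. by have [z e] := bracket_ham; exact: involutive_powers e m k. Qed.

End HamiltonianFlow.

Section Representations.
Variables (F : fieldType) (G : groupType) (N : nat).
Local Notation A := (galg F G).
Local Notation AA := (galg F (G * G)%type).

Definition matrix_representation (Q : comAlgType F) (X : A -> 'M[Q]_N) : Prop :=
  [/\ forall i j, linear (fun a => X a i j), X 1 = 1%:M & forall a b, X (a * b) = X a *m X b].

Lemma repX_representation : matrix_representation (@repX F G N).
Proof.
split=> [i j c a b||a b]; [|apply/matrixP => i j..]; rewrite !mxE.
- rewrite -linearZ -raddfD; apply/iprojP/ideal_sub; exact: rep_rel_lin.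
- rewrite -(rmorph_nat (iproj (@rep_proper F G N))); apply/iprojP/ideal_sub.
  exact: rep_rel_one.
under eq_bigr => r _ do rewrite !mxE -rmorphM.
rewrite -raddf_sum; apply/iprojP/ideal_sub; exact: rep_rel_mul.
Qed.

Lemma twistedX_representation (t : twist F N) :
  matrix_representation (@twistedX F G N t).
Proof.
have [Xl X1 XM] := repX_representation; rewrite /twistedX.
split=> [i j c a b||a b]; last by rewrite XM map_mxM.
- rewrite ![map_mx _ _ _ _]mxE Xl; exact: iproj_is_linear.
by rewrite X1 map_mx1.
Qed.

Section HamiltonianVectorField.
Variables (Q : comAlgType F) (X : A -> 'M[Q]_N).
Hypothesis XP : matrix_representation X.

Lemma tens_entry_lin k j i l : linear (fun d => tens_entry X d k j i l).
Proof. exact: glin_is_linear. Qed.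

Lemma sum_tens_entry (d : AA) k l :
  \sum_i tens_entry X d k i i l = X (mult d) k l.
Proof.
have [Xl _ XM] := XP.
move: d; apply: galg_ext => [c x y|c x y|[g h]].
- rewrite scaler_sumr -big_split; apply: eq_bigr => i _.
  exact: tens_entry_lin.
- by rewrite linearP Xl.
rewrite /mult glin_gel /= gelM XM mxE; apply: eq_bigr => i _.
by rewrite /tens_entry glin_gel.
Qed.

Lemma mxtrace_cls a : cls a = 0 -> \tr (X a) = 0.
Proof.
have [Xl _ XM] := XP => /lprojP; rewrite subr0 => -[s [Ss ->]].
have trl : linear (fun a => \tr (X a)).
  move=> c x y; rewrite /mxtrace scaler_sumr -big_split.
  by apply: eq_bigr => i _; exact: Xl.
elim: s Ss => [|x s IHs] Ss; first by rewrite big_nil (linear_map0 trl).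
rewrite big_cons trl IHs; last by move=> y ys; apply: Ss; rewrite inE ys orbT.
have [|a1 [b1 ->]] := Ss x; first by rewrite inE eqxx.
by rewrite addr0 addrC -scaleN1r trl !XM mxtrace_mulC scaleN1r addNr scaler0.
Qed.

Variables (dbr : A -> A -> AA) (br : Q -> Q -> Q).
Hypothesis brP : biderivation br.

Definition trace_flow (a : A) : Prop :=
  forall b k l, br (\tr (X a)) (X b k l) = X (mult (dbr a b)) k l.

Lemma bracket_sumr (I : finType) x (f : I -> Q) :
  br x (\sum_i f i) = \sum_i br x (f i).
Proof.
have [[_ r] _ _ _] := brP.
by apply: big_morph => [y z|]; [have := r x 1 y z; rewrite !scale1r
  | exact: linear_map0].
Qed.

Lemma bracket_suml (I : finType) x (f : I -> Q) :
  br (\sum_i f i) x = \sum_i br (f i) x.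
Proof.
have [[l _] _ _ _] := brP.
apply: (big_morph (br^~ x)) => [y z|]; last exact: (linear_map0 (l x)).
by have := l x 1 y z; rewrite !scale1r.
Qed.

Lemma trace_flow_involutive a b :
  trace_flow a -> cls (mult (dbr a b)) = 0 -> br (\tr (X a)) (\tr (X b)) = 0.
Proof.
move=> fa /mxtrace_cls <-; rewrite [\tr (X b)]/mxtrace bracket_sumr.
by apply: eq_bigr => k _; exact: fa.
Qed.

End HamiltonianVectorField.

Lemma rep_trace_flow (dbr : A -> A -> AA) br (a : A) :
  rep_bracket dbr br -> trace_flow (@repX F G N) dbr br a.
Proof.
move=> [brB brE] b k l; rewrite /mxtrace bracket_suml //.
rewrite -(sum_tens_entry repX_representation); apply: eq_bigr => i _.
exact: brE.
Qed.

(* When a is invariant both halves of the twisted bracket sum to the flow of  *)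
(* the double bracket, the second one after reindexing along tau.             *)
Lemma twisted_trace_flow (t : twist F N) (dbr : A -> A -> AA) br (a : A) :
    2 != 0 :> F -> ginv a = a -> twisted_bracket dbr br ->
  trace_flow (@twistedX F G N t) dbr br a.
Proof.
move=> two_neq0 aE [brB brE] b k l; rewrite /mxtrace bracket_suml //.
under eq_bigr => i _ do rewrite brE aE sgn_sq mulr1 -scalerDr.
rewrite -scaler_sumr big_split /=.
pose T i := tens_entry (@twistedX F G N t) (dbr a b) k i i l.
have TE : \sum_i T (tau t i) = \sum_i T i.
  by rewrite [RHS](reindex_inj (@tau_inj F N t)).
rewrite [X in _ *: (_ + X)]TE /T.
rewrite sum_tens_entry; last exact: twistedX_representation.
rewrite -mulr2n -scaler_nat scalerA (mulVf two_neq0); exact: scale1r.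
Qed.

End Representations.

Lemma rep_first_integralsP (F : fieldType) (N : nat) (lambda : F)
    (dbr : laurent F -> laurent F -> galg F (free_group bool * free_group bool)%type)
    (Q : comAlgType F) (X : laurent F -> 'M[Q]_N) (br : Q -> Q -> Q) :
    2 != 0 :> F -> laurent_bracket dbr -> matrix_representation X ->
    biderivation br -> (forall m, trace_flow X dbr br (ham lambda ^+ m)) ->
  rep_first_integrals lambda X br.
Proof.
move=> two_neq0 dbrP XP brB flow; have [Xl _ XM] := XP.
have XP1 c a b : X (c *: a + b) = c%:A *: X a + X b.
  by apply/matrixP => i j; rewrite Xl !mxE mulr_algl.
have X0 : X 0 = 0 by apply/matrixP => i j; rewrite mxE; exact: linear_map0 (Xl i j).
have XD a b : X (a + b) = X a + X b by rewrite -[a]scale1r XP1 !scale1r.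
have XZ c a : X (c *: a) = c%:A *: X a by rewrite -[c *: a]addr0 XP1 X0 addr0.
have XN a : X (- a) = - X a by rewrite -scaleN1r XZ scaleN1r scaleN1r.
have flowE a : map_mx (br (\tr (X (ham lambda)))) (X a) = X (mult (dbr (ham lambda) a)).
  by apply/matrixP => i j; rewrite mxE; exact: (flow 1%N).
split=> [||m m_gt0|m k m_gt0 k_gt0].
- rewrite !flowE (flow_u lambda two_neq0 dbrP) (flow_v lambda two_neq0 dbrP).
  by split; rewrite !XD !XN !XZ !XM.
- by rewrite flowE (flow_commutator lambda two_neq0 dbrP) X0.
- case: m m_gt0 => // m _; apply: (trace_flow_involutive XP brB (flow 1%N)).
  exact: (involutive_ham lambda two_neq0 dbrP 0 m).
case: m m_gt0 => // m _; case: k k_gt0 => // k _.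
apply: (trace_flow_involutive XP brB (flow m.+1)).
exact: involutive_ham.
Qed.

Theorem theorem7p1 (R : realType) (lambda : R[i])
    (dbr : laurent R[i] -> laurent R[i] ->
           galg R[i] (free_group bool * free_group bool)%type)
    (dbrP : laurent_bracket dbr) :
  let h := ham lambda in
  let ddt (a : laurent R[i]) := mult (dbr h a) in
  [/\ ddt u = u * v - u * v' - lambda *: v' + lambda *: (u * v * u) /\
      ddt v = v * u' - v * u + lambda *: u' - lambda *: (v * u * v),
      ddt (v * u * v' * u') = 0,
      (forall m, (0 < m)%N ->
         phi (h ^+ m) = h ^+ m /\ cls (ddt (h ^+ m)) = 0) /\
      (forall m k, (0 < m)%N -> (0 < k)%N ->
         sharp dbr (cls (h ^+ m)) (cls (h ^+ k)) = 0) &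
      [/\ forall (N : nat)
            (br : rep_ring R[i] (free_group bool) N -> rep_ring _ _ N ->
                  rep_ring _ _ N),
            (0 < N)%N -> rep_bracket dbr br ->
            rep_first_integrals lambda (@repX _ _ N) br,
          forall (N : nat) (t := orthogonal_twist R[i] N)
            (br : twisted_ring (free_group bool) t ->
                  twisted_ring _ t -> twisted_ring _ t),
            (0 < N)%N -> twisted_bracket dbr br ->
            rep_first_integrals lambda (@twistedX _ _ N t) br &
          forall (n : nat) (t := symplectic_twist R[i] n)
            (br : twisted_ring (free_group bool) t ->
                  twisted_ring _ t -> twisted_ring _ t),
            (0 < n)%N -> twisted_bracket dbr br ->
            rep_first_integrals lambda (@twistedX _ _ (n + n) t) br]].
Proof.
have two_neq0 : 2 != 0 :> R[i] by rewrite Num.Theory.pnatr_eq0.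
have [dbrD _ _ _] := dbrP.
move=> h ddt; split; [split | | split | split].
- exact: flow_u.
- exact: flow_v.
- exact: flow_commutator.
- case=> // m _; split; first exact: phi_ham_exp.
  exact: (involutive_ham lambda two_neq0 dbrP 0 m).
- case=> // m [//|k] _ _; rewrite sharp_cls //; exact: involutive_ham.
- move=> N br _ brP; apply: (rep_first_integralsP two_neq0 dbrP) => [||m].
  + exact: repX_representation.
  + exact: brP.1.
  + exact: rep_trace_flow.
- move=> N t br _ brP; apply: (rep_first_integralsP two_neq0 dbrP) => [||m].
  + exact: twistedX_representation.
  + exact: brP.1.
  + exact: (twisted_trace_flow two_neq0 (phi_ham_exp lambda m) brP).
move=> n t br _ brP; apply: (rep_first_integralsP two_neq0 dbrP) => [||m].
- exact: twistedX_representation.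
- exact: brP.1.
- exact: (twisted_trace_flow two_neq0 (phi_ham_exp lambda m) brP).
Qed.
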